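(* Let $\Lambda_1(\alpha)$ be a nuclear power series space of finite type and let $\theta\in\Lambda_1(\alpha)$. The Rhaly operator $R_\theta:\Lambda_1(\alpha)\to\Lambda_1(\alpha)$ is compact if and only if $\theta\in(\Lambda_1(\alpha))'$.
   Context: $\mathbb{N}=\{1,2,\dots\}$, $\mathbb{N}_0=\{0,1,2,\dots\}$. $\alpha=(\alpha_n)_{n\in\mathbb{N}}$ is a non-negative increasing sequence tending to $\infty$. The power series space of finite type is $\Lambda_1(\alpha)=\{x=(x_n)_{n\in\mathbb{N}}:\|x\|_k:=\sum_{n=1}^\infty|x_n|e^{-\frac1k\alpha_n}<\infty\ \text{for all }k\in\mathbb{N}\}$, a Fréchet space with the seminorms $\|\cdot\|_k$; it is nuclear if and only if $\lim_{n\to\infty}\frac{\ln n}{\alpha_n}=0$. Its dual is identified with the sequence space $(\Lambda_1(\alpha))'=\{y=(y_n)_{n\in\mathbb{N}}:\sup_{n\in\mathbb{N}}|y_n|e^{\frac1k\alpha_n}<\infty\ \text{for some }k\in\mathbb{N}\}$. $e_n$ is the sequence with $1$ in the $n$-th place and $0$ elsewhere. A sequence $\theta=(\theta_n)_{n\in\mathbb{N}_0}$ is viewed as an element of a sequence space indexed by $\mathbb{N}$ by taking $\theta_{n-1}$ as its $n$-th coordinate (so $\theta\in(\Lambda_1(\alpha))'$ means $\sup_n|\theta_{n-1}|e^{\frac1k\alpha_n}<\infty$ for some $k$). The Rhaly operator $R_\theta$ is defined by $R_\theta e_n=\sum_{j=n}^\infty \theta_{j-1}e_j$ and $R_\theta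 x=\sum_{n=1}^\infty x_nR_\theta e_n=\sum_{n=1}^\infty\big(\sum_{j=1}^n x_j\big)\theta_{n-1}e_n$. A linear map $T:E\to F$ is compact if $T(U)$ is precompact in $F$ for some neighborhood $U$ of zero in $E$. *)

(* Defs.v *)
From HB Require Import structures.
From mathcomp Require Import all_boot all_order all_algebra.
From mathcomp Require Import all_classical all_reals all_analysis.
From mathcomp Require Import complex.
Set Implicit Arguments.
Unset Strict Implicit.
Unset Printing Implicit Defensive.
Import Order.TTheory GRing.Theory Num.Theory.
Import numFieldTopology.Exports numFieldNormedType.Exports.
Local Open Scope classical_set_scope.
Local Open Scope convex_scope.
Local Open Scope ring_scope.

Inductive scalar_kind := RealScalars | ComplexScalars.

Definition scalars (R : realType) (s : scalar_kind) : numFieldType :=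
  match s with RealScalars => R | ComplexScalars => R[i]%C end.

(* [`|z|] lives in the scalar field itself; [absv z] is the same modulus read
   in [R]. *)
Definition absv (R : realType) (s : scalar_kind) : scalars R s -> R :=
  match s with
  | RealScalars => fun z : R => `|z|
  | ComplexScalars => fun z : R[i]%C => Normc.normc z
  end.

Section absv_theory.
Variables (R : realType) (s : scalar_kind).
Local Notation K := (scalars R s).
Implicit Types x y : K.

Lemma absv_ge0 x : 0 <= absv x.
Proof. by case: s x => //= -[a b] /=; rewrite sqrtr_ge0. Qed.

Lemma absv0 : absv (0 : K) = 0.
Proof. by case: s => /=; [rewrite normr0 | exact: Normc.normc0]. Qed.

Lemma absvD x y : absv (x + y) <= absv x + absv y.
Proof. by case: s x y => /= x y; [exact: ler_normD | exact: le_normcD]. Qed.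

Lemma absvM x y : absv (x * y) = absv x * absv y.
Proof. by case: s x y => /= x y; [exact: normrM | exact: Normc.normcM]. Qed.

Lemma absvN x : absv (- x) = absv x.
Proof. by case: s x => /= x; [exact: normrN | exact: normcN]. Qed.

Lemma absv_small (e : R) : 0 < e ->
  exists2 d : K, 0 < d & forall z : K, `|z| < d -> absv z < e.
Proof.
move=> e0; case: s => /=; first by exists e.
exists (real_complex R e); first by rewrite ltcR.
by move=> z; rewrite normc_def -ltcR; case: z.
Qed.

Lemma absv_conv (l : K) : 0 <= l -> l <= 1 -> absv l + absv (1 - l) = 1.
Proof.
case: s l => /= l l0 l1.
  by rewrite ger0_norm// ger0_norm ?subr_ge0// addrC subrK.
move: l0 l1; case: l => a b; rewrite !lecE /= => /andP[/eqP b0 a0] /andP[_ a1].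
rewrite b0 subrr expr0n /= !addr0 !sqrtr_sqr ger0_norm// ger0_norm ?subr_ge0//.
by rewrite addrC subrK.
Qed.

End absv_theory.

Section locally_convex.
Variables (R : realType) (s : scalar_kind).
Local Notation K := (scalars R s).

Definition continuous_seminorm (E : tvsType K) (p : E -> R) :=
  [/\ forall x y, p (x + y) <= p x + p y,
      forall (c : K) x, p (c *: x) = absv c * p x
    & continuous p].

(* The canonical map between the local spaces E/ker q -> E/ker p is a nuclear
   operator: x = \sum_i f_i(x) y_i with \sum_i |f_i|_q p(y_i) < oo, where
   M i bounds the dual norm |f_i|_q.  Since E/ker p is dense in its completion,
   it makes no difference to take the y_i in E. *)
Definition nuclear_local_map (E : tvsType K) (q p : E -> R) :=
  exists (f : nat -> {linear E -> K^o}) (y : nat -> E) (M : nat -> R),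
    [/\ forall i, 0 <= M i,
        forall i x, absv (f i x) <= M i * q x,
        (\sum_(0 <= i <oo) (M i * p (y i))%:E < +oo)%E
      & forall x, p (x - \sum_(0 <= i < n) f i x *: y i) @[n --> \oo] --> 0].

Definition nuclear_space (E : tvsType K) :=
  forall p : E -> R, continuous_seminorm p ->
  exists2 q : E -> R, continuous_seminorm q & nuclear_local_map q p.

(* Precompact in the sense of topological vector spaces; the library's
   [precompact] is relative compactness. *)
Definition totally_bounded (F : tvsType K) (A : set F) :=
  forall V : set F, nbhs 0 V ->
  exists2 B : set F, finite_set B &
    A `<=` \bigcup_(b in B) [set b + v | v in V].

Definition compact_operator (E F : tvsType K) (T : {linear E -> F}) :=
  exists2 U : set E, nbhs 0 U & totally_bounded (T @` U).

End locally_convex.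

(* Sequences indexed by {1, 2, ...} are shifted to start at 0: [a n] stands for
   the (n+1)-st term, and the seminorm of index k in {1, 2, ...} is the one of
   index k-1 below. *)
Record exponent_seq (R : realType) := ExponentSeq {
  exponents :> nat -> R;
  exponents_ge0 : forall n, 0 <= exponents n;
  exponents_nd : {homo exponents : m n / (m <= n)%N >-> m <= n};
  exponents_cvg : exponents n @[n --> \oo] --> +oo }.

Section power_series_space.
Variables (R : realType) (s : scalar_kind) (a : exponent_seq R).
Local Notation K := (scalars R s).
Implicit Types x y : nat -> K^o.

Definition psnorm (k : nat) (x : nat -> K^o) : \bar R :=
  (\sum_(0 <= n <oo) (absv (x n) * expR (- (a n / k.+1%:R)))%:E)%E.

Definition Lambda1_pred : {pred nat -> K^o} :=
  [pred x : nat -> K^o | `[< forall k, (psnorm k x < +oo)%E >]].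

Let term_ge0 k x n : (0 <= (absv (x n) * expR (- (a n / k.+1%:R)))%:E)%E.
Proof. by rewrite lee_fin mulr_ge0 ?absv_ge0 ?expR_ge0. Qed.

Lemma psnorm_ge0 k x : (0 <= psnorm k x)%E.
Proof. by apply: nneseries_ge0 => n _ _; exact: term_ge0. Qed.

Lemma psnorm0 k : psnorm k 0 = 0%E.
Proof. by apply: eseries0 => n _ _; rewrite absv0 mul0r. Qed.

Lemma psnormD k x y : (psnorm k (x + y)%R <= psnorm k x + psnorm k y)%E.
Proof.
rewrite /psnorm -nneseriesD//; [|by move=> *; exact: term_ge0..].
apply: lee_nneseries => n; first by move=> _ _; exact: term_ge0.
by move=> _; rewrite -EFinD lee_fin -mulrDl ler_wpM2r ?expR_ge0// absvD.
Qed.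

Lemma psnormZ k (c : K) x : psnorm k (c *: x)%R = ((absv c)%:E * psnorm k x)%E.
Proof.
rewrite /psnorm -nneseriesZl; last by move=> n _; exact: term_ge0.
by apply: eq_eseriesr => n _; rewrite -EFinM mulrA -absvM.
Qed.

Lemma psnormN k x : psnorm k (- x) = psnorm k x.
Proof. by apply: eq_eseriesr => n _; rewrite absvN. Qed.

Lemma psnorm_index k m x : (k <= m)%N -> (psnorm k x <= psnorm m x)%E.
Proof.
move=> km; apply: lee_nneseries => n; first by move=> _ _; exact: term_ge0.
move=> _; rewrite lee_fin ler_wpM2l ?absv_ge0// ler_expR lerN2.
by rewrite ler_wpM2l ?exponents_ge0// lef_pV2 ?posrE ?ltr0n// ler_nat.
Qed.

Lemma psnorm_coord k x n :
  ((absv (x n) * expR (- (a n / k.+1%:R)))%:E <= psnorm k x)%E.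
Proof.
rewrite (le_trans _ (nneseries_lim_ge n.+1 _))//.
by rewrite big_nat_recr//= leeDr// sume_ge0.
Qed.


Lemma Lambda1_submod_closed : submod_closed Lambda1_pred.
Proof.
split; first by apply/asboolP => k; rewrite psnorm0.
move=> c x y /asboolP px /asboolP py; apply/asboolP => k.
apply: (le_lt_trans (psnormD _ _ _)); rewrite psnormZ lte_add_pinfty//.
by rewrite lte_mul_pinfty// lee_fin absv_ge0.
Qed.

HB.instance Definition _ :=
  GRing.isSubmodClosed.Build _ _ Lambda1_pred Lambda1_submod_closed.

Record Lambda1 := MkLambda1 {
  coords :> nat -> K^o;
  coordsP : coords \in Lambda1_pred }.

HB.instance Definition _ := [isSub for coords].
HB.instance Definition _ := [Choice of Lambda1 by <:].
HB.instance Definition _ := [SubChoice_isSubLmodule of Lambda1 by <:].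

Definition snorm (k : nat) (x : Lambda1) : R := fine (psnorm k x).

Implicit Types X Y Z : Lambda1.

Lemma snormE k X : (snorm k X)%:E = psnorm k X.
Proof. by rewrite fineK// ge0_fin_numE ?psnorm_ge0//; case: X => x /= /asboolP. Qed.

Lemma snorm_ge0 k X : 0 <= snorm k X.
Proof. by rewrite -lee_fin snormE psnorm_ge0. Qed.

Lemma snorm0 k : snorm k 0 = 0.
Proof. by rewrite /snorm psnorm0. Qed.

Lemma snormD k X Y : snorm k (X + Y) <= snorm k X + snorm k Y.
Proof. by rewrite -lee_fin EFinD !snormE psnormD. Qed.

Lemma snormZ k (c : K) X : snorm k (c *: X) = absv c * snorm k X.
Proof. by apply: EFin_inj; rewrite EFinM !snormE psnormZ. Qed.

Lemma snormN k X : snorm k (- X) = snorm k X.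
Proof. by apply: EFin_inj; rewrite !snormE psnormN. Qed.

Lemma snormBC k X Y : snorm k (X - Y) = snorm k (Y - X).
Proof. by rewrite -snormN opprB. Qed.

Lemma snorm_index k m X : (k <= m)%N -> snorm k X <= snorm m X.
Proof. by move=> km; rewrite -lee_fin !snormE psnorm_index. Qed.

Lemma snorm_coord k X n :
  absv (X n) * expR (- (a n / k.+1%:R)) <= snorm k X.
Proof. by rewrite -lee_fin snormE psnorm_coord. Qed.

Definition Lambda1_entourage : set_system (Lambda1 * Lambda1) :=
  [set A | exists k : nat, exists2 e : R, 0 < e &
             forall X Y, snorm k (X - Y) < e -> A (X, Y)].

Let entourage_filter : Filter Lambda1_entourage.
Proof.
split.
- by exists 0%N, 1.
- move=> A B [k [e e0 kA]] [m [d d0 mB]].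
  exists (maxn k m); exists (Num.min e d); first by rewrite lt_min e0 d0.
  move=> X Y; rewrite lt_min => /andP[he hd]; split.
    by apply: kA; apply: le_lt_trans he; rewrite snorm_index// leq_maxl.
  by apply: mB; apply: le_lt_trans hd; rewrite snorm_index// leq_maxr.
- move=> A B AB [k [e e0 kA]]; exists k, e => // X Y /kA; exact: AB.
Qed.

Let entourage_diagonal (A : set (Lambda1 * Lambda1)) :
  Lambda1_entourage A -> (diagonal `<=` A).
Proof.
move=> [k [e e0 kA]] [X Y]; rewrite /diagonal /= => ->.
by apply: kA; rewrite subrr snorm0.
Qed.

Let entourage_inv (A : set (Lambda1 * Lambda1)) :
  Lambda1_entourage A -> Lambda1_entourage A^-1%relation.
Proof.
by move=> [k [e e0 kA]]; exists k, e => // X Y; rewrite snormBC => /kA.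
Qed.

Let entourage_split_ex (A : set (Lambda1 * Lambda1)) : Lambda1_entourage A ->
  exists2 B, Lambda1_entourage B & (B \; B)%relation `<=` A.
Proof.
move=> [k [e e0 kA]]; exists [set Z | snorm k (Z.1 - Z.2) < e / 2].
  by exists k, (e / 2) => //; rewrite divr_gt0.
move=> [X Y] [Z /= h1 h2]; apply: kA.
rewrite -[X](subrK Z) -addrA (splitr e).
by apply: le_lt_trans (ltrD h1 h2); exact: snormD.
Qed.

HB.instance Definition _ := isUniform.Build Lambda1 entourage_filter
  entourage_diagonal entourage_inv entourage_split_ex.

Lemma entourage_Lambda1 : @entourage Lambda1 = Lambda1_entourage.
Proof. by []. Qed.

Lemma nbhs_Lambda1 X (A : set Lambda1) :
  nbhs X A <-> exists k : nat, exists2 e : R, 0 < e &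
    forall Y, snorm k (X - Y) < e -> A Y.
Proof.
split.
  rewrite -nbhs_entourageE /nbhs_ /= entourage_Lambda1 => -[B [k [e e0 kB]] BA]; exists k, e => // Y /kB h.
  by apply: BA; apply/xsectionP.
move=> [k [e e0 kA]]; rewrite -nbhs_entourageE /nbhs_ /= entourage_Lambda1.
exists [set Z | snorm k (Z.1 - Z.2) < e].
  by exists k; exists e; [exact: e0 | move=> Y Z h; exact: h].
by move=> Y /xsectionP; exact: kA.
Qed.

Let Lambda1_add_continuous : continuous (fun Z : Lambda1 * Lambda1 => Z.1 + Z.2).
Proof.
move=> [X Y] A /= /nbhs_Lambda1[k [e e0 kA]].
exists ([set Z | snorm k (X - Z) < e / 2], [set Z | snorm k (Y - Z) < e / 2]).
  by split; apply/nbhs_Lambda1; exists k, (e / 2) => //; rewrite divr_gt0.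
move=> [X' Y'] /= [h1 h2]; apply: kA.
rewrite opprD addrACA (splitr e).
by apply: le_lt_trans (ltrD h1 h2); exact: snormD.
Qed.

Let Lambda1_scale_continuous : continuous (fun z : K^o * Lambda1 => z.1 *: z.2).
Proof.
move=> [c X] A /= /nbhs_Lambda1[k [e e0 kA]].
have X1 : 0 < snorm k X + 1 by rewrite ltr_wpDl// snorm_ge0.
have c1 : 0 < absv c + 1 by rewrite ltr_wpDl// absv_ge0.
have eX : 0 < e / 2 / (snorm k X + 1) by rewrite !divr_gt0.
have ec : 0 < e / 2 / (absv c + 1) by rewrite !divr_gt0.
have [d1 d10 hd1] := absv_small s (ltr01 : 0 < 1 :> R).
have [d2 d20 hd2] := absv_small s eX.
exists ([set z : K^o | `|c - z| < d1] `&` [set z : K^o | `|c - z| < d2],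
        [set Z | snorm k (X - Z) < e / 2 / (absv c + 1)]).
  split; last by apply/nbhs_Lambda1; exists k, (e / 2 / (absv c + 1)).
  apply: filterI; apply/(@nbhs_ballP K K^o).
    by exists d1 => //= z; rewrite -ball_normE.
  by exists d2 => //= z; rewrite -ball_normE.
move=> [c' X'] /= [[/hd1 h1 /hd2 h2] h3]; apply: kA.
have -> : c *: X - c' *: X' = (c - c') *: X + c' *: (X - X').
  by rewrite scalerBl scalerBr addrA subrK.
apply: le_lt_trans (snormD _ _ _) _; rewrite !snormZ (splitr e) ltr_leD//.
  apply: (@le_lt_trans _ _ (absv (c - c') * (snorm k X + 1))).
    by rewrite ler_wpM2l ?absv_ge0// lerDl.
  by rewrite -ltr_pdivlMr.
apply: (@le_trans _ _ ((absv c + 1) * snorm k (X - X'))).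
  rewrite ler_wpM2r ?snorm_ge0//.
  rewrite -[c' : K](subKr c) (le_trans (absvD _ _))// lerD2l absvN.
  exact: ltW.
by rewrite mulrC -ler_pdivlMr//; exact: ltW.
Qed.

Let Lambda1_locally_convex :
  exists2 B : set_system Lambda1, (forall b, b \in B -> convex_set b) & basis B.
Proof.
exists [set b | exists k : nat, exists X, exists2 e : R, 0 < e &
                  b = [set Y | snorm k (X - Y) < e]].
  move=> b; rewrite inE => -[k [X [e e0 ->]]] Y Z l; rewrite !inE /= => hY hZ.
  set l' := l%:num : K.
  have l0 : 0 <= l' by exact: (ge0 l).
  have l1 : l' <= 1 by exact: (le1 l).
  have -> : X - (Y : convex_lmodType Lambda1) <| l |> Z =
            l' *: (X - Y) + (1 - l') *: (X - Z).
    rewrite [Y <| l |> Z]/(l' *: Y + (1 - l') *: Z).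
    rewrite !scalerBr addrACA -scalerDl [l' + _]addrC subrK scale1r.
    by rewrite -opprD.
  apply: (le_lt_trans (snormD _ _ _)); rewrite !snormZ.
  have [l'0|l'0] := eqVneq (absv l') 0.
    move: (absv_conv l0 l1); rewrite l'0 add0r => ->.
    by rewrite mul0r add0r mul1r.
  rewrite -[e]mul1r -(absv_conv l0 l1) mulrDl ltr_leD//.
    by rewrite ltr_pM2l// lt_def l'0 absv_ge0.
  by rewrite ler_wpM2l ?absv_ge0// ltW.
split.
  move=> b [k [X [e e0 ->]]]; rewrite openE => Y /= hY; apply/nbhs_Lambda1.
  exists k, (e - snorm k (X - Y)); first by rewrite subr_gt0.
  move=> Z hZ /=; rewrite -[X](subrK Y) -addrA.
  by apply: le_lt_trans (snormD _ _ _) _; rewrite -ltrBrDl.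
move=> X A /nbhs_Lambda1[k [e e0 kA]].
exists [set Y | snorm k (X - Y) < e] => //.
by split; [exists k, X, e | rewrite /= subrr snorm0].
Qed.

HB.instance Definition _ := PreTopologicalNmodule_isTopologicalNmodule.Build
  Lambda1 Lambda1_add_continuous.
HB.instance Definition _ := TopologicalNmodule_isTopologicalLmodule.Build
  K Lambda1 Lambda1_scale_continuous.
HB.instance Definition _ := Uniform_isTvs.Build K Lambda1 Lambda1_locally_convex.

(* Identified with the topological dual through <x, y> = \sum_n x_n y_n. *)
Definition Lambda1_dual (y : nat -> K^o) :=
  exists k : nat,
    (ereal_sup (range (fun n => (absv (y n) * expR (a n / k.+1%:R))%:E)) < +oo)%E.

(* Coordinate form of R_theta x = \sum_n x_n R_theta e_n, where
   R_theta e_n = \sum_(j >= n) theta_j e_j (indices starting at 0). *)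
Definition rhaly_seq (theta x : nat -> K^o) : nat -> K^o :=
  fun n => (\sum_(0 <= j < n.+1) x j) * theta n.

Lemma absv_partial_sum k X n :
  absv (\sum_(0 <= j < n.+1) X j) * expR (- (a n / k.+1%:R)) <= snorm k X.
Proof.
apply: (@le_trans _ _ (\sum_(0 <= j < n.+1) absv (X j) *
                                            expR (- (a n / k.+1%:R)))).
  rewrite -mulr_suml ler_wpM2r ?expR_ge0//.
  elim: n => [|n IH]; first by rewrite !big_nat1.
  rewrite big_nat_recr//= [leRHS]big_nat_recr//=.
  by rewrite (le_trans (absvD _ _))// lerD2r.
rewrite -lee_fin snormE; apply: le_trans (nneseries_lim_ge n.+1 _); last first.
  by move=> i _ _; exact: term_ge0.
rewrite sumEFin lee_fin !big_nat; apply: ler_sum => j /andP[_ jn].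
rewrite ler_wpM2l ?absv_ge0// ler_expR lerN2 ler_wpM2r ?invr_ge0//.
exact: exponents_nd.
Qed.

Lemma rhaly_seq_Lambda1 (theta X : Lambda1) : rhaly_seq theta X \in Lambda1_pred.
Proof.
apply/asboolP => k; set m := k.*2.+1.
have wE n : expR (- (a n / k.+1%:R)) =
            expR (- (a n / m.+1%:R)) * expR (- (a n / m.+1%:R)).
  rewrite -expRD -opprD -mulrDr; congr (expR (- (_ * _))).
  have -> : (m.+1 = 2 * k.+1)%N by rewrite mul2n doubleS.
  by rewrite natrM invfM -mulrDl -[2^-1]mul1r -splitr mul1r.
apply: (@le_lt_trans _ _ ((snorm m X)%:E * psnorm m theta)%E); last first.
  by rewrite -snormE -EFinM ltry.
rewrite /psnorm -nneseriesZl; last by move=> n _; exact: term_ge0.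
apply: lee_nneseries => n; first by move=> _ _; exact: term_ge0.
move=> _; rewrite -EFinM lee_fin absvM wE mulrACA.
by rewrite ler_wpM2r ?mulr_ge0 ?absv_ge0 ?expR_ge0// absv_partial_sum.
Qed.

Definition Rhaly (theta X : Lambda1) : Lambda1 :=
  MkLambda1 (rhaly_seq_Lambda1 theta X).

Lemma Rhaly_linear theta : linear (Rhaly theta).
Proof.
move=> c X Y; apply/val_inj/funext => n /=.
rewrite /rhaly_seq big_split -scaler_sumr.
by rewrite mulrDl -scalerAl.
Qed.

HB.instance Definition _ theta :=
  GRing.isLinear.Build K Lambda1 Lambda1 _ (Rhaly theta) (Rhaly_linear theta).

End power_series_space.

(* Main.v *)
(* Testing compactness on multiples of the unit vectors gives the decay of
   theta.  Conversely, if |theta_n| e^(alpha_n/k) is bounded then R_theta maps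
   the k-th unit ball into a set of uniformly bounded sequences, since
   |x_1 + ... + x_n| <= e^(alpha_n/k) on that ball; by the Grothendieck-Pietsch
   criterion, sum_n e^(-alpha_n/k) < oo for all k, such a set is precompact. *)
Require Import Defs.
From mathcomp Require Import all_boot all_order all_algebra.
From mathcomp Require Import all_classical all_reals all_analysis.
From mathcomp Require Import complex.
Set Implicit Arguments.
Unset Strict Implicit.
Unset Printing Implicit Defensive.

Import Order.TTheory GRing.Theory Num.Theory.
Import numFieldTopology.Exports numFieldNormedType.Exports.

Section rhaly.
Local Open Scope classical_set_scope.
Local Open Scope ring_scope.
Variables (R : realType) (s : scalar_kind).
Local Notation K := (scalars R s).

(** * Scalars of prescribed modulus and finite nets in the scalar field *)

Lemma absv_surj (r : R) : 0 <= r -> exists c : K, absv c = r.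
Proof.
move=> r0; case: s => /=; first by exists r; rewrite ger0_norm.
exists (real_complex R r); rewrite /= expr0n addr0 sqrtr_sqr.
by rewrite ger0_norm.
Qed.

(** The net is a grid of mesh [e] starting at [- C]; rounding [(z + C) / e] down selects the grid
    point. *)
Lemma finite_net_real (C e : R) : 0 < e ->
  exists2 G : set R, finite_set G &
    forall z : R, `|z| <= C -> exists2 g, G g & `|z - g| < e.
Proof.
move=> e0; pose M := Num.truncn ((C + C) / e).
exists [set i%:R * e - C | i in `I_M.+1].
  by apply: finite_image; exact: finite_II.
move=> z; rewrite ler_norml => /andP[zC1 zC2].
have zC : 0 <= (z + C) / e by rewrite divr_ge0 ?(ltW e0)// -lerBlDr sub0r.
have /andP[h1 h2] := truncn_itv zC.
exists ((Num.truncn ((z + C) / e))%:R * e - C).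
  exists (Num.truncn ((z + C) / e)) => //=.
  by rewrite ltnS le_truncn// ler_pM2r ?invr_gt0// lerD2r.
move: h1 h2; set t := Num.truncn _.
rewrite ler_pdivlMr// ltr_pdivrMr// -natr1 [(_ + 1) * e]mulrDl mul1r => h1 h2.
rewrite opprB addrA ger0_norm ?subr_ge0//.
by rewrite ltrBlDl.
Qed.

Lemma finite_net_scalars (C e : R) : 0 < e ->
  exists2 G : set K, finite_set G &
    forall z : K, absv z <= C -> exists2 g, G g & absv (z - g) < e.
Proof.
case: s => /= e0; first exact: finite_net_real.
have e20 : 0 < e / 2 by rewrite divr_gt0.
have [G Gf GP] := finite_net_real C e20.
(* Real and imaginary parts are approximated separately within [e / 2]; the modulus is at most the
   sum of the two errors. *)
exists [set Complex x y | x in G & y in G]; first exact: finite_image2.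
move=> [x y] /= xyC.
have xC : `|x| <= C.
  by rewrite (le_trans _ xyC)// -sqrtr_sqr ler_wsqrtr// lerDl sqr_ge0.
have yC : `|y| <= C.
  by rewrite (le_trans _ xyC)// -sqrtr_sqr ler_wsqrtr// lerDr sqr_ge0.
have [g Gg gx] := GP _ xC; have [h Gh hy] := GP _ yC.
exists (Complex g h); first by exists g => //; exists h.
have -> : Complex x y - Complex g h =
    Complex (x - g) 0 + Complex 0 (y - h) :> R[i]%C.
  by apply/eqP; rewrite eq_complex /= addr0 add0r !eqxx.
apply: le_lt_trans (le_normcD _ _) _.
by rewrite /= !expr0n /= addr0 add0r !sqrtr_sqr (splitr e) ltrD.
Qed.

Variable a : exponent_seq R.
Local Notation L := (Lambda1 s a).
Implicit Types X Y : L.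

(** * Multiples of the unit vectors *)

Lemma psnorm_delta k (c : K) n :
  psnorm a k (fun j => if j == n then c else 0 : K^o) =
  (absv c * expR (- (a n / k.+1%:R)))%:E.
Proof.
rewrite /psnorm (@nneseriesD1 _ _ n)//; last first.
  by move=> j _; rewrite lee_fin mulr_ge0 ?absv_ge0 ?expR_ge0.
rewrite eqxx eseries0 ?adde0// => j _ /negbTE ->.
by rewrite absv0 mul0r.
Qed.

Lemma delta_Lambda1 (c : K) n :
  (fun j => if j == n then c else 0 : K^o) \in @Lambda1_pred R s a.
Proof. by apply/asboolP => k; rewrite psnorm_delta ltry. Qed.

Definition delta (c : K) n : L := MkLambda1 (delta_Lambda1 c n).

Lemma snorm_delta k (c : K) n :
  snorm k (delta c n) = absv c * expR (- (a n / k.+1%:R)).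
Proof. by rewrite /snorm psnorm_delta. Qed.

Lemma Rhaly_delta (theta : L) (c : K) n : Rhaly theta (delta c n) n = c * theta n.
Proof.
rewrite /= /rhaly_seq big_nat_recr//= eqxx big_nat big1 ?add0r// => j /andP[_ jn].
by rewrite ltn_eqF.
Qed.

(** * From nuclearity to summable weights *)

Lemma continuous_seminorm_snorm k : continuous_seminorm (@snorm R s a k).
Proof.
split; [exact: snormD|exact: snormZ|].
move=> X; have FX := @nbhs_filter L X.
apply/(@cvgrPdist_lt _ _ _ _ FX) => e e0; apply/nbhs_Lambda1; exists k, e => // Y XY.
have leD (Z W : L) : snorm k Z <= snorm k (Z - W) + snorm k W.
  by rewrite -{1}(subrK W Z) snormD.
rewrite ltr_norml ltrNl opprB !ltrBlDr; apply/andP; split.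
  by apply: le_lt_trans (leD Y X) _; rewrite snormBC ltrD2r.
by apply: le_lt_trans (leD X Y) _; rewrite ltrD2r.
Qed.

(** Replaces an abstract seminorm by a concrete ball, inside which multiples of unit vectors can be
    chosen explicitly. *)
Lemma continuous_seminorm_small (q : L -> R) : continuous_seminorm q ->
  exists m, exists2 e : R, 0 < e & forall X, snorm m X < e -> q X < 1.
Proof.
move=> [_ qZ qc]; have q0 : q 0 = 0 by rewrite -(scale0r 0) qZ absv0 mul0r.
have F0 := @nbhs_filter L 0.
have /(@cvgrPdist_lt _ _ _ _ F0) /(_ _ ltr01) /nbhs_Lambda1[m [e e0 H]] := qc 0.
exists m, e => // X Xe; move: (H X); rewrite sub0r snormN => /(_ Xe).
by rewrite q0 sub0r normrN; exact: le_lt_trans (ler_norm _).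
Qed.

(* A seminorm dominates each weighted coordinate functional, so the nuclear
   expansion converges coordinatewise. *)
Lemma nuclear_coord_le (q : L -> R) k (f : nat -> {linear L -> K^o})
    (y : nat -> L) (M : nat -> R) :
  (forall i, 0 <= M i) -> (forall i x, absv (f i x) <= M i * q x) ->
  (forall x, snorm k (x - \sum_(0 <= i < n) f i x *: y i) @[n --> \oo] --> 0) ->
  forall X n, q X < 1 ->
  ((absv (X n) * expR (- (a n / k.+1%:R)))%:E <=
  \sum_(0 <= i <oo) (M i * (absv (y i n) * expR (- (a n / k.+1%:R))))%:E)%E.
Proof.
move=> M0 fM fcvg X n qX; set w := expR _.
have t0 i : (0 <= (M i * (absv (y i n) * w))%:E)%E.
  by rewrite lee_fin !mulr_ge0 ?absv_ge0 ?expR_ge0.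
set S := (\sum_(0 <= i <oo) _)%E.
have [->|Sfin] := eqVneq S +oo%E; first by rewrite leey.
have S0 : (0 <= S)%E by apply: nneseries_ge0.
have SE : S = (fine S)%:E by rewrite fineK// ge0_fin_numE// ltey.
rewrite SE lee_fin -subr_le0.
(* The remainders tend to 0 in the [k]-th seminorm, so it suffices to bound the excess over [S] by
   each of them. *)
rewrite -(cvg_lim _ (fcvg X))//; apply: limr_ge.
  by apply/cvg_ex; exists 0; exact: fcvg.
apply: nearW => N.
set Z := \sum_(0 <= i < N) _.
rewrite lerBlDr.
have h1 : absv ((X - Z) n) * w <= snorm k (X - Z) by exact: snorm_coord.
apply: (@le_trans _ _ (absv ((X - Z) n) * w + absv (Z n) * w)).
  rewrite -mulrDl ler_wpM2r ?expR_ge0//.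
  rewrite -[X in leLHS](subrK Z) /=; exact: absvD.
apply: lerD => //.
(* Since [q X < 1], each coefficient [f i X] has modulus at most [M i]. *)
apply: (@le_trans _ _ (\sum_(0 <= i < N) M i * (absv (y i n) * w))); last first.
  rewrite -lee_fin -SE -sumEFin; apply: nneseries_lim_ge => i _ _; exact: t0.
move: @Z {h1} => Z; rewrite {}/Z; elim: N => [|N IH]; first by rewrite !big_geq// absv0 mul0r.
rewrite !big_nat_recr//=.
apply: (@le_trans _ _ (absv ((\sum_(0 <= i < N) f i X *: y i) n) * w +
   absv (f N X * y N n) * w)).
  by rewrite -mulrDl ler_wpM2r ?expR_ge0// absvD.
apply: lerD => //.
rewrite absvM -mulrA ler_wpM2r ?mulr_ge0 ?absv_ge0 ?expR_ge0//.
by rewrite (le_trans (fM _ _))// -[leRHS]mulr1 ler_wpM2l// ltW.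
Qed.

(* Applied to multiples of the unit vectors, [nuclear_coord_le] bounds the
   weights by a summable double series: the Grothendieck-Pietsch criterion. *)
Lemma nuclear_summable k : nuclear_space L ->
  (\sum_(0 <= n <oo) (expR (- (a n / k.+1%:R)))%:E < +oo)%E.
Proof.
move=> /(_ _ (continuous_seminorm_snorm k))[q qsemi [f [y [M [M0 fM Mfin fcvg]]]]].
have [m [e e0 qe]] := continuous_seminorm_small qsemi.
have e20 : 0 < e / 2 by rewrite divr_gt0.
pose w n := expR (- (a n / k.+1%:R)).
have coordle n : ((e / 2 * w n)%:E <=
    \sum_(0 <= i <oo) (M i * (absv (y i n) * w n))%:E)%E.
  (* With [c] of this modulus, [delta c n] has [m]-th seminorm [e / 2], hence [q] is below 1 there,
     while [c] still has modulus at least [e / 2]. *)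
  have c0 : 0 <= e / 2 * expR (a n / m.+1%:R).
    by rewrite mulr_ge0 ?expR_ge0// ltW.
  have [c cE] := absv_surj c0.
  have := @nuclear_coord_le q k f y M M0 fM fcvg (delta c n) n.
  rewrite /= eqxx; move=> H; apply: le_trans (H _); last first.
    apply: qe; rewrite snorm_delta cE -mulrA -expRD subrr expR0 mulr1.
    by rewrite ltr_pdivrMr// ltr_pMr// ltr1n.
  rewrite lee_fin cE ler_wpM2r ?expR_ge0// ler_peMr ?(ltW e20)//.
  by rewrite -expR0 ler_expR divr_ge0// exponents_ge0.
have e2V : e / 2 != 0 by rewrite gt_eqF.
rewrite (_ : (\sum_(0 <= n <oo) _)%E =
    ((e / 2)^-1%:E * \sum_(0 <= n <oo) (e / 2 * w n)%:E)%E); last first.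
  rewrite -nneseriesZl; last first.
    by move=> i _; rewrite lee_fin mulr_ge0 ?expR_ge0// ltW.
  by apply: eq_eseriesr => n _; rewrite -EFinM mulrA mulVf// mul1r.
rewrite lte_mul_pinfty ?lee_fin ?invr_ge0 ?(ltW e20)//.
apply: le_lt_trans Mfin.
apply: (@le_trans _ _ (\sum_(0 <= n <oo)
    \sum_(0 <= i <oo) (M i * (absv (y i n) * w n))%:E)%E).
  apply: lee_nneseries => // i _ _.
  by rewrite lee_fin mulr_ge0 ?expR_ge0// ltW.
(* All terms are nonnegative; summing over [n] first recovers [M i * snorm k (y i)]. *)
rewrite nneseries_interchange; last first.
  by move=> i j; rewrite lee_fin !mulr_ge0 ?absv_ge0 ?expR_ge0.
apply: lee_nneseries => i.
  move=> _ _; apply: nneseries_ge0 => n _ _.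
  by rewrite lee_fin !mulr_ge0 ?absv_ge0 ?expR_ge0.
move=> _; rewrite EFinM snormE /psnorm -nneseriesZl//.
by move=> n _; rewrite lee_fin mulr_ge0 ?absv_ge0 ?expR_ge0.
Qed.

(** * Compactness implies membership in the dual *)

Lemma totally_bounded_snorm (A : set L) m : totally_bounded A ->
  exists D : R, forall X, A X -> snorm m X <= D.
Proof.
move=> /(_ [set Y | snorm m Y < 1])[].
  by apply/nbhs_Lambda1; exists m, 1 => // Y; rewrite sub0r snormN.
move=> B /finite_seqP[r ->] AB.
(* The sum over all centers serves as an upper bound for the seminorm of each one. *)
exists (\sum_(b <- r) snorm m b + 1) => X /AB[b /= br [v /= v1 <-]].
apply: le_trans (snormD _ _ _) _; apply: lerD; last exact: ltW.
rewrite (big_rem b)//= lerDl sumr_ge0// => i _; exact: snorm_ge0.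
Qed.

Lemma compact_Rhaly_dual (theta : L) :
  compact_operator (Rhaly theta) -> Lambda1_dual a theta.
Proof.
move=> [U /nbhs_Lambda1[k [e e0 kU]] Utb].
(* Here [m.+1] is twice [k.+1], so [expR (a n / k.+1%:R)] is the square of [expR (a n / m.+1%:R)]:
   one factor cancels the weight of the [m]-th seminorm, the other is the dual weight. *)
pose m := k.*2.+1; have [D DP] := totally_bounded_snorm m Utb.
exists m; apply: (@le_lt_trans _ _ (D / (e / 2))%:E); last exact: ltry.
apply: ge_ereal_sup => _ [n _ <-]; rewrite lee_fin.
have e20 : 0 < e / 2 by rewrite divr_gt0.
have c0 : 0 <= e / 2 * expR (a n / k.+1%:R).
  by rewrite mulr_ge0 ?expR_ge0// ltW.
have [c cE] := absv_surj c0.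
have /DP : (Rhaly theta @` U) (Rhaly theta (delta c n)).
  exists (delta c n) => //; apply: kU; rewrite sub0r snormN snorm_delta cE.
  rewrite -mulrA -expRD subrr expR0 mulr1.
  by rewrite ltr_pdivrMr// ltr_pMr// ltr1n.
move/(le_trans (snorm_coord _ _ n)); rewrite Rhaly_delta absvM cE.
rewrite ler_pdivlMr//; apply: le_trans; rewrite le_eqVlt; apply/predU1P; left.
have -> : a n / k.+1%:R = a n / m.+1%:R + a n / m.+1%:R.
  rewrite /m -doubleS -mul2n natrM invfM -mulrDr -mulrDl.
  by rewrite -[2^-1]mul1r -splitr mul1r.
rewrite expRD expRN.
have h0 : expR (a n / m.+1%:R) != 0 by rewrite gt_eqF// expR_gt0.
by rewrite [RHS]mulrAC mulrA mulfK// mulrC [absv _ * _]mulrC mulrA.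
Qed.

(** * Precompactness of coordinatewise bounded sets, and the converse *)

Lemma finite_net_coords (C e : R) N : 0 < e ->
  exists2 B : set L, finite_set B &
    forall Y, (forall n, absv (Y n) <= C) -> exists2 b, B b &
      forall n, (n < N)%N /\ absv ((Y - b) n) < e \/ (N <= n)%N /\ b n = 0.
Proof.
move=> e0; have [G Gf GP] := finite_net_scalars C e0.
elim: N => [|N [B Bf BP]].
  exists [set 0]; first exact: finite_set1.
  by move=> Y _; exists 0 => // n; right.
(* Only coordinate [N] changes, so net points still vanish further on and subtracting one leaves the
   tail of [Y] intact. *)
exists [set b + delta g N | b in B & g in G]; first exact: finite_image2.
move=> Y YC; have [b Bb bY] := BP _ YC; have [g Gg gY] := GP _ (YC N).
exists (b + delta g N); first by exists b => //; exists g.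
have coordE n : (b + delta g N) n = b n + (if n == N then g else 0) by [].
have coordBE n : (Y - (b + delta g N)) n = Y n - (b n + (if n == N then g else 0)).
  by [].
move=> n; rewrite coordBE coordE; case: (ltngtP n N) => nN.
- left; rewrite addr0; split; first exact: ltnW.
  by case: (bY n) => [[_]//|[]]; rewrite leqNgt nN.
- right; split=> //; rewrite addr0.
  by case: (bY n) => [[]|[]//]; rewrite ltnNge ltnW.
- left; split; first by rewrite nN.
  by case: (bY n) => [[]|[_ ->]]; rewrite ?add0r ?nN// ltnn.
Qed.

(* Nuclearity makes the tails of the seminorms of these sets uniformly small,
   which reduces precompactness to finitely many coordinates. *)
Lemma totally_bounded_coords (A : set L) (C : R) : nuclear_space L ->
  (forall X n, A X -> absv (X n) <= C) -> totally_bounded A.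
Proof.
move=> nuc AC V /nbhs_Lambda1[p [e e0 eV]].
have sfin := nuclear_summable p nuc.
pose w n := expR (- (a n / p.+1%:R)).
have w0 n : 0 <= w n by exact: expR_ge0.
have w1 n : w n <= 1.
  by rewrite -expR0 ler_expR oppr_le0 divr_ge0// exponents_ge0.
have C1 : 0 < `|C| + 1 by rewrite ltr_wpDl.
have e20 : 0 < e / 2 by rewrite divr_gt0.
(* Beyond [N], coordinates bounded by [C] contribute less than [e / 2]; the divisor is positive
   whatever the sign of [C]. *)
have [N Ntail] : exists N, (\sum_(N <= n <oo) (w n)%:E < (e / 2 / (`|C| + 1))%:E)%E.
  have /fine_cvgP[fnum] : (\sum_(N <= k <oo) (w k)%:E @[N --> \oo] --> 0)%E.
    by apply: nneseries_tail_cvg => // k _; rewrite lee_fin.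
  move=> /cvgrPdist_lt /(_ _ (divr_gt0 e20 C1)) h.
  near \oo => N; exists N.
  have fN : (\sum_(N <= k <oo) (w k)%:E)%E \is a fin_num by near: N.
  rewrite -(fineK fN) lte_fin; apply: le_lt_trans (ler_norm _) _.
  by rewrite -normrN -sub0r; near: N.
have N1 : 0 < N%:R + 1 :> R by rewrite ltr_wpDl.
(* The [N] leading coordinates have weights at most 1, so this mesh keeps their total within
   [e / 2]; [N + 1] avoids a zero divisor. *)
have [B Bf BP] := finite_net_coords C N (divr_gt0 e20 N1).
exists B => // X AX; have [b Bb bX] := BP X (fun n => AC X n AX).
exists b => //; exists (X - b); last by rewrite addrC subrK.
apply: eV; rewrite sub0r snormN.
rewrite -lte_fin snormE /psnorm (@nneseries_split _ _ 0 N); last first.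
  by move=> n _; rewrite lee_fin mulr_ge0 ?absv_ge0.
rewrite add0n sumEFin (splitr e) EFinD; apply: lee_ltD => //.
- rewrite lee_fin.
  apply: (@le_trans _ _ (\sum_(0 <= n < N) (e / 2 / (N%:R + 1)))).
    rewrite !big_nat; apply: ler_sum => n /andP[_ nN].
    case: (bX n) => [[_ h]|[]]; last by rewrite leqNgt nN.
    rewrite -[leRHS]mulr1 ler_pM ?absv_ge0 ?w0 ?w1//; exact: ltW.
  rewrite big_const_nat subn0 iter_addr_0 -[leLHS]mulr_natr -[leLHS]mulrA ler_piMr ?(ltW e20)//.
  by rewrite mulrC ler_pdivrMr// mul1r lerDl.
apply: (@le_lt_trans _ _ ((`|C| + 1)%:E * \sum_(N <= n <oo) (w n)%:E)%E).
  rewrite -nneseriesZl; last by move=> n _; rewrite lee_fin.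
  rewrite [leLHS]eseries_cond [leRHS]eseries_cond; apply: lee_nneseries => n.
    by move=> _ _; rewrite lee_fin mulr_ge0 ?absv_ge0.
  move=> /= nN; rewrite -EFinM lee_fin ler_wpM2r//.
  case: (bX n) => [[]|[_ bn]]; first by rewrite ltnNge nN.
  suff : absv (X n - b n) <= `|C| + 1 by [].
  rewrite bn subr0 (le_trans (AC X n AX))// (le_trans (ler_norm C))//.
  by rewrite lerDl.
by rewrite muleC -lte_pdivlMr// -EFinM mulrC.
Unshelve. all: by end_near.
Qed.

Lemma dual_compact_Rhaly (theta : L) : nuclear_space L ->
  Lambda1_dual a theta -> compact_operator (Rhaly theta).
Proof.
move=> nuc [k]; set S := ereal_sup _ => Soo.
have term n : ((absv (theta n) * expR (a n / k.+1%:R))%:E <= S)%E.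
  by apply: ereal_sup_ubound; exists n.
(* The term of index 0 gives [0 <= S], which excludes the value [-oo]. *)
have Sfin : S \is a fin_num.
  rewrite ge0_fin_numE//; apply: le_trans (term 0%N).
  by rewrite lee_fin mulr_ge0 ?absv_ge0 ?expR_ge0.
exists [set X | snorm k X < 1].
  by apply/nbhs_Lambda1; exists k, 1 => // Y; rewrite sub0r snormN.
apply: (@totally_bounded_coords _ (fine S)) => // _ n [X /= X1 <-].
have h1 := term n; rewrite -(fineK Sfin) lee_fin in h1.
have h2 := le_trans (absv_partial_sum k X n) (ltW X1).
apply: le_trans h1; rewrite /rhaly_seq absvM mulrC ler_wpM2l ?absv_ge0//.
by rewrite -[leRHS]mul1r -ler_pdivrMr ?expR_gt0// -expRN.
Qed.

End rhaly.

Theorem theorem3p8 (R : realType) (s : scalar_kind) (alpha : exponent_seq R)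
    (Lambda1_nuclear : nuclear_space (Lambda1 s alpha))
    (theta : Lambda1 s alpha) :
  compact_operator (Rhaly theta) <-> Lambda1_dual alpha theta.
Proof.
split; first exact: compact_Rhaly_dual.
exact: dual_compact_Rhaly.
Qed.
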